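(* Let $X=\mathbb{R}^n$ with the standard inner product and induced norm $\|\cdot\|$, and let $\mathfrak{q}=\tfrac12\|\cdot\|^2$. Let $f\colon X\to\left]-\infty,+\infty\right]$ be convex, lower semicontinuous and proper, and let $\lambda\in\left]0,1\right[$. Set $\mu=\lambda/(2-\lambda)$, and let $S_\lambda f=\operatorname{pav}(f,\mathfrak{q};1-\lambda,\lambda)$, where $\operatorname{pav}$ denotes the proximal average. Then the following hold. (i) $S_\lambda f=(1-\lambda)\,e_\mu f\circ\left(\tfrac{2}{2-\lambda}\operatorname{Id}\right)+\mu\mathfrak{q}$; that is, for every $x\in X$, $(S_\lambda f)(x)=(1-\lambda)\,(e_\mu f)\left(\tfrac{2x}{2-\lambda}\right)+\mu\,\mathfrak{q}(x)$, where $e_\mu f$ is the Moreau envelope of $f$. (ii) $(S_\lambda f)^*=S_\lambda(f^* )$.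
   Context: $X=\mathbb{R}^n$ is the standard Euclidean space with inner product $\langle\cdot,\cdot\rangle$ and induced norm $\|\cdot\|$; $\mathfrak{q}=\tfrac12\|\cdot\|^2$; $\operatorname{Id}\colon X\to X\colon x\mapsto x$ is the identity operator. Fenchel conjugate: $f^*(x^* )=\sup_{x\in X}\big(\langle x,x^*\rangle-f(x)\big)$. Infimal convolution: $(f_1\,\square\, f_2)(x)=\inf_{y\in X}\big(f_1(y)+f_2(x-y)\big)$. Moreau envelope: for $\mu>0$, $e_\mu f=f\,\square\,\mu^{-1}\mathfrak{q}$, i.e. $(e_\mu f)(x)=\inf_{y\in X}\big(f(y)+\tfrac{1}{2\mu}\|x-y\|^2\big)$. Proximal average: for convex, lower semicontinuous and proper functions $f_1,f_2\colon X\to\left]-\infty,+\infty\right]$ and $\lambda_1,\lambda_2>0$ with $\lambda_1+\lambda_2=1$, $$\operatorname{pav}(f_1,f_2;\lambda_1,\lambda_2)=\big(\lambda_1(f_1+\mathfrak{q})^*+\lambda_2(f_2+\mathfrak{q})^*\big)^*-\mathfrak{q}.$$ Smoothing operator $S_\lambda$: for $f\colon X\to\left]-\infty,+\infty\right]$ convex, lower semicontinuous and proper, and $\lambda\in\left]0,1\right[$, $S_\lambda f=\operatorname{pav}(f,\mathfrak{q};1-\lambda,\lambda)$. *)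

(* Defs.v *)
From HB Require Import structures.
From mathcomp Require Import all_boot all_order all_algebra.
From mathcomp Require Import all_classical all_reals all_analysis.

Set Implicit Arguments.
Unset Strict Implicit.
Unset Printing Implicit Defensive.

Import Order.TTheory GRing.Theory Num.Theory.
Import numFieldNormedType.Exports.

Local Open Scope classical_set_scope.
Local Open Scope ring_scope.

(* R^n is 'rV[R]_n. The library norm `|x| on 'rV[R]_n is the sup norm, so the
   Euclidean norm is defined here; the canonical topology of 'rV[R]_n (used by
   lower_semicontinuous) is the Euclidean one, as all norms are equivalent. *)

Definition inner (R : realType) (n : nat) (x y : 'rV[R]_n) : R :=
  \sum_(i < n) x ord0 i * y ord0 i.

Definition enorm (R : realType) (n : nat) (x : 'rV[R]_n) : R :=
  Num.sqrt (inner x x).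

Definition frakq (R : realType) (n : nat) (x : 'rV[R]_n) : R :=
  2^-1 * enorm x ^+ 2.

Local Open Scope ereal_scope.

(* Meant for functions that do not take the value -oo, for which the
   right-hand side never involves +oo - oo. *)
Definition econvex (R : realType) (n : nat) (f : 'rV[R]_n -> \bar R) : Prop :=
  forall (x y : 'rV[R]_n) (t : R), (0 < t < 1)%R ->
    f (t *: x + (1 - t) *: y)%R <= t%:E * f x + (1 - t)%:E * f y.

Definition proper_fun (R : realType) (n : nat) (f : 'rV[R]_n -> \bar R) : Prop :=
  (forall x, -oo < f x) /\ (exists x, f x < +oo).

Definition fenchel (R : realType) (n : nat) (f : 'rV[R]_n -> \bar R)
    (u : 'rV[R]_n) : \bar R :=
  ereal_sup (range (fun x => (inner x u)%:E - f x)).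

Definition infconv (R : realType) (n : nat) (f1 f2 : 'rV[R]_n -> \bar R)
    (x : 'rV[R]_n) : \bar R :=
  ereal_inf (range (fun y => f1 y + f2 (x - y)%R)).

Definition moreau (R : realType) (n : nat) (mu : R) (f : 'rV[R]_n -> \bar R) :
    'rV[R]_n -> \bar R :=
  infconv f (fun z => (mu^-1 * frakq z)%:E).

Definition pav (R : realType) (n : nat) (f1 f2 : 'rV[R]_n -> \bar R)
    (l1 l2 : R) (x : 'rV[R]_n) : \bar R :=
  fenchel (fun u => l1%:E * fenchel (fun z => f1 z + (frakq z)%:E) u
                  + l2%:E * fenchel (fun z => f2 z + (frakq z)%:E) u) x
  - (frakq x)%:E.

Definition smoothing (R : realType) (n : nat) (lambda : R)
    (f : 'rV[R]_n -> \bar R) : 'rV[R]_n -> \bar R :=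
  pav f (fun x => (frakq x)%:E) (1 - lambda) lambda.

(* Main.v *)
(* Call (p, w) a subgradient pair of f when w is a subgradient of f at p.  For
   such a pair the Fenchel inequality is an equality, so f^* is known at w, and
   (w, p) is a subgradient pair of f^*.  As f is convex, lsc and proper,
   f + |y - .|^2 / (2 mu) has a minimiser p, so every y is p + mu w for some
   subgradient pair, and then (e_mu f)(y) = f(p) + mu q(w).
   Let b = lambda / 2.  Adding and scaling subgradients of the conjugates that
   enter the proximal average, p + w attains the supremum that defines
   (S_lambda f)(x) at x = (1 - b) p + b w, which gives its value
   (1 - lambda) (f(p) + mu q(w)) + mu q(x).  This is (i), because
   2 x / (2 - lambda) = p + mu w.
   Exchanging p and w, the same formula computes S_lambda (f^* ) at
   u = (1 - b) w + b p; since u is also a subgradient of S_lambda f at x,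
   (S_lambda f)^* (u) = <x, u> - (S_lambda f)(x), and the two values agree. *)

Require Import Defs.
From HB Require Import structures.
From mathcomp Require Import all_boot all_order all_algebra.
From mathcomp Require Import all_classical all_reals all_analysis.
From mathcomp Require Import ring lra.

Set Implicit Arguments.
Unset Strict Implicit.

Import Order.TTheory GRing.Theory Num.Theory.
Import numFieldNormedType.Exports.

Local Open Scope classical_set_scope.
Local Open Scope ring_scope.

(** * The Euclidean inner product and its comparison with the sup norm *)

Section Inner.
Context {R : realType} {n : nat}.
Implicit Types (x y z : 'rV[R]_n) (a : R).

Lemma innerC x y : inner x y = inner y x.
Proof. by apply: eq_bigr => i _; rewrite mulrC. Qed.

Lemma innerDl x y z : inner (x + y) z = inner x z + inner y z.
Proof. by rewrite -big_split; apply: eq_bigr => i _; rewrite !mxE mulrDl. Qed.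

Lemma innerZl a x y : inner (a *: x) y = a * inner x y.
Proof. by rewrite /inner mulr_sumr; apply: eq_bigr => i _; rewrite !mxE mulrA. Qed.

Lemma innerNl x y : inner (- x) y = - inner x y.
Proof. by rewrite -scaleN1r innerZl mulN1r. Qed.

Lemma innerDr x y z : inner x (y + z) = inner x y + inner x z.
Proof. by rewrite !(innerC x) innerDl. Qed.

Lemma innerZr a x y : inner x (a *: y) = a * inner x y.
Proof. by rewrite !(innerC x) innerZl. Qed.

Lemma innerNr x y : inner x (- y) = - inner x y.
Proof. by rewrite !(innerC x) innerNl. Qed.

Definition innerE := (innerDl, innerDr, innerNl, innerNr, innerZl, innerZr).

Lemma inner_ge0 x : 0 <= inner x x.
Proof. by apply: sumr_ge0 => i _; rewrite -expr2 sqr_ge0. Qed.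

Lemma frakqE x : frakq x = 2^-1 * inner x x.
Proof. by rewrite /frakq /enorm sqr_sqrtr ?inner_ge0. Qed.

Lemma frakq_ge0 x : 0 <= frakq x.
Proof. by rewrite frakqE mulr_ge0 ?inner_ge0 ?invr_ge0. Qed.

(** The sup norm is attained at a coordinate, whose square is one term of the sum. This makes
    [frakq] coercive for the norm in which [bounded_set] is stated. *)
Lemma sqr_norm_le_inner x : `|x| ^+ 2 <= inner x x.
Proof.
have [->|x0] := eqVneq x 0; first by rewrite normr0 expr0n inner_ge0.
have [|i xi] := @mx_norm_neq0 R 1 n x; first by rewrite -[mx_norm x]/`|x| normr_eq0.
rewrite -[`|x|]/(mx_norm x) xi real_normK ?num_real//.
rewrite /inner (bigD1 i.2)//= (ord1 i.1) expr2 lerDl.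
by apply: sumr_ge0 => j _; rewrite -expr2 sqr_ge0.
Qed.

Lemma continuous_inner_diag : continuous (fun x => inner x x).
Proof.
apply: continuous_big; first exact: add_continuous.
by move=> i _ x; apply: continuousM; exact: coord_continuous.
Qed.

End Inner.

(** * Lower semicontinuity and attainment of minima *)

Local Open Scope ereal_scope.

(** A threshold [a] below the sum splits as [b + (a - b)]: near [x], [f] stays above [b] and [h]
    above [a - b]. *)
Lemma lower_semicontinuousD_continuous (R : realType) (T : topologicalType)
    (f : T -> \bar R) (h : T -> R) :
  (forall x, -oo < f x) -> lower_semicontinuous f -> continuous h ->
  lower_semicontinuous (fun x => f x + (h x)%:E).
Proof.
move=> fNy f_lsc h_cont x a ax.
have [b /andP[ab bf]] : exists b : R, (a - h x < b)%R && (b%:E < f x).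
  case: (f x) (fNy x) ax => [r|_ _|//].
    move=> _; rewrite -EFinD lte_fin => ar.
    exists ((a - h x + r) / 2)%R.
    by rewrite lte_fin; apply/andP; split; lra.
  by exists (a - h x + 1)%R; rewrite ltry andbT ltrDl.
have [V Vx Vf] := f_lsc x b bf.
exists (V `&` [set y | (a - b < h y)%R]).
  apply: filterI => //.
  by apply: (cvgr_gt (h x)); [exact: h_cont|lra].
move=> y [/Vf bfy /= hy].
apply: (@lt_trans _ _ (b + h y)%:E); first by rewrite lte_fin; lra.
by rewrite EFinD lteD2rE.
Qed.

Lemma seq_has_min {d} {T : eqType} {O : orderType d} (g : T -> O) {x : T}
    {s : seq T} :
  x \in s -> exists i, forall j, j \in s -> (g i <= g j)%O.
Proof.
elim: s x => // y s IH x _.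
case: s IH => [_|x1 s /(_ x1)[|i imin]]; last 2 first.
- exact: mem_head.
- have [iy|yi] := leP (g i) (g y).
    by exists i => j; rewrite in_cons => /predU1P[->//|]; exact: imin.
  exists y => j; rewrite in_cons => /predU1P[->//|js].
  by rewrite (le_trans (ltW yi))// imin.
- by exists y => j; rewrite mem_seq1 => /eqP ->.
Qed.

Lemma lower_semicontinuous_has_min (R : realType) (n : nat)
    (g : 'rV[R]_n -> \bar R) (a : R) :
  (forall x, -oo < g x) -> lower_semicontinuous g ->
  [set x | g x <= a%:E] !=set0 -> bounded_set [set x | g x <= a%:E] ->
  exists p, forall z, g p <= g z.
Proof.
move=> gNy /lower_semicontinuousP g_open [x0 x0a] bdd.
have [//|nomin] := pselect (exists p, forall z, g p <= g z); exfalso.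
have below z : exists2 z', g z' < g z & g z' \is a fin_num.
  have [z' z'z] : exists z', g z' < g z.
    have [//|H] := pselect (exists z', g z' < g z); exfalso.
    apply: nomin; exists z => z'.
    by rewrite leNgt; apply/negP => zz'; apply: H; exists z'.
  by exists z' => //; rewrite fin_numElt gNy (lt_le_trans z'z)// leey.
(* Without a minimum the open sets [g z' < g] cover the compact sublevel set;
   in a finite subcover, no set contains a z' with the least value. *)
have : compact [set x | g x <= a%:E].
  apply: bounded_closed_compact => //.
  rewrite (_ : [set x | _] = ~` [set x | a%:E < g x]).
    by apply: open_closedC; exact: g_open.
  by apply/seteqP; split => x /=; rewrite leNgt => /negP.
rewrite compact_cover => /(_ _ [set z' | g z' \is a fin_num]
  (fun z' => [set z | g z' < g z])) [||D' D'fin Dcov].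
- by move=> z' /= z'fin; rewrite -(fineK z'fin); exact: g_open.
- by move=> z _; have [z' z'z z'fin] := below z; exists z'.
have [y0 y0D y0x0] := Dcov _ x0a.
have [i imin] := seq_has_min g y0D.
have ia : g i <= a%:E.
  by apply: (le_trans (imin _ y0D)); apply: ltW; exact: (lt_le_trans y0x0).
have [y yD] := Dcov _ ia.
by rewrite /= ltNge imin.
Qed.

Lemma continuous_moreau_kernel (R : realType) (n : nat) (c : R) (y : 'rV[R]_n) :
  continuous (fun z : 'rV[R]_n => c * frakq (y - z))%R.
Proof.
rewrite (_ : (fun z => _) =
    (fun t : R => (c / 2 * t)%R) \o (fun x : 'rV[R]_n => inner x x)
      \o (fun z : 'rV[R]_n => y - z)%R).
  move=> z; apply: continuous_comp.
    apply: (@continuousB R 'rV[R]_n 'rV[R]_n (fun=> y) id).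
      exact: cst_continuous.
    exact: cvg_id.
  apply: continuous_comp; first exact: continuous_inner_diag.
  exact: mulrl_continuous.
by apply/funext => z /=; rewrite frakqE mulrA.
Qed.

(** The real value [r] of [f] at [p] is carried along, so that values at subgradient pairs are
    computed in [R]. *)
Definition subgradient {R : realType} {n : nat} (f : 'rV[R]_n -> \bar R)
    (p : 'rV[R]_n) (r : R) (w : 'rV[R]_n) : Prop :=
  f p = r%:E /\ forall z, (r + inner w (z - p))%:E <= f z.

(** * Calculus of subgradient pairs under conjugation, sums and Moreau envelopes *)

Section Subgradient.
Context {R : realType} {n : nat}.
Implicit Types (f g : 'rV[R]_n -> \bar R) (p u v w x y z : 'rV[R]_n) (r s : R).

Lemma fenchel_subgradient f p r w :
  subgradient f p r w -> fenchel f w = (inner p w - r)%:E.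
Proof.
move=> [fp fge]; apply/eqP; rewrite eq_le; apply/andP; split.
  apply: ge_ereal_sup => _ [z _ <-]; move: (fge z).
  case: (f z) => [s| |] //; last by rewrite addeNy leNye.
  by rewrite -EFinB !lee_fin !innerE (innerC w p) (innerC w z); lra.
by apply: ereal_sup_ubound; exists p => //; rewrite fp.
Qed.

(** The affine function of [u] given by [inner p u - r] is one of those whose supremum is
    [fenchel f], and it touches it at [w]. *)
Lemma subgradient_fenchel f p r w :
  subgradient f p r w -> subgradient (fenchel f) w (inner p w - r) p.
Proof.
move=> fpw; split; first exact: fenchel_subgradient.
move=> u; apply: ereal_sup_ubound; exists p => //; rewrite fpw.1 -EFinB.
by congr EFin; rewrite !innerE; lra.
Qed.

Lemma subgradientD f g p r s v w :
  subgradient f p r v -> subgradient g p s w ->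
  subgradient (fun z => f z + g z) p (r + s) (v + w).
Proof.
move=> [fp fge] [gp gge]; split; first by rewrite fp gp.
move=> z; apply: le_trans (leeD (fge z) (gge z)).
by rewrite -EFinD lee_fin !innerE; lra.
Qed.

Lemma subgradientZ (a : R) f p r w : (0 < a)%R ->
  subgradient f p r w -> subgradient (fun z => a%:E * f z) p (a * r) (a *: w).
Proof.
move=> a0 [fp fge]; split; first by rewrite fp.
move=> z; rewrite innerZl -mulrDr EFinM lee_pmul2l ?lte_fin//.
Qed.

Lemma subgradient_frakq p : subgradient (fun z => (frakq z)%:E) p (frakq p) p.
Proof.
split=> // z; rewrite lee_fin !frakqE.
by have := inner_ge0 (z - p); rewrite !innerE (innerC z p); lra.
Qed.

(** The infimum is attained at [p]: once [f z] is replaced by its affine minorant, the excess at [z]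
    is exactly [mu^-1 * frakq (z - p)]. *)
Lemma moreau_subgradient (mu : R) f p r w : (0 < mu)%R ->
  subgradient f p r w -> moreau mu f (p + mu *: w)%R = (r + mu * frakq w)%:E.
Proof.
move=> mu0 [fp fge]; apply/eqP; rewrite eq_le; apply/andP; split.
  apply: ereal_inf_lbound; exists p => //; rewrite fp -EFinD.
  congr EFin; rewrite !frakqE !innerE (innerC p w).
  by field; rewrite gt_eqF.
apply: le_ereal_inf_tmp => _ [z _ <-]; apply: le_trans (leeD2r _ (fge z)).
rewrite -EFinD lee_fin.
have : (0 <= mu^-1 * frakq (z - p))%R by rewrite mulr_ge0 ?frakq_ge0 ?invr_ge0 ?ltW.
rewrite !frakqE !innerE (innerC w p) (innerC z p) (innerC z w).
rewrite -subr_ge0 => H; rewrite -subr_ge0; move: H; congr (0 <= _)%R; rewrite subr0.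
by field; rewrite gt_eqF.
Qed.

End Subgradient.

(** * Existence of proximal points *)

(* Lower semicontinuity bounds f below near x0, and convexity along the segment
   from x0 to z propagates the bound with linear loss. *)
Lemma convex_lsc_norm_minorant (R : realType) (n : nat) (f : 'rV[R]_n -> \bar R) :
  econvex f -> lower_semicontinuous f -> proper_fun f ->
  exists x0 A B, [/\ f x0 < +oo, (0 < B)%R &
    forall z, (A - B * `|z - x0|)%:E <= f z].
Proof.
move=> f_convex f_lsc [fNy [x0 fx0]].
have [r0 fx0E] : exists r0, f x0 = r0%:E.
  by exists (fine (f x0)); rewrite fineK// fin_numElt fNy.
have [|V /nbhs_ballP[e /= e0 eV] Vf] := f_lsc x0 (r0 - 1)%R.
  by rewrite fx0E lte_fin; lra.
have near_ge y : (`|x0 - y| < e)%R -> (r0 - 1)%:E < f y.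
  by move=> xy; apply/Vf/eV; rewrite -ball_normE.
exists x0, (r0 - 1)%R, (2 / e)%R; split => //; first by rewrite divr_gt0.
move=> z; have [ze|ez] := ltP `|z - x0|%R e.
  apply/ltW/(le_lt_trans _ (near_ge z _)); last by rewrite distrC.
  by rewrite lee_fin lerBlDr lerDl mulr_ge0// divr_ge0// ltW.
set N := `|z - x0|%R in ez *.
have N0 : (0 < N)%R by apply: lt_le_trans ez.
(* This [t] puts the point of the segment at distance [e / 2] from [x0], inside the ball where the
   bound holds; then [1 / t] is [2 / e * N]. *)
pose t := (e / 2 / N)%R.
have t01 : (0 < t < 1)%R.
  by rewrite /t !divr_gt0//= ltr_pdivrMr// mul1r; lra.
have /andP[t0 t1] := t01.
have := f_convex z x0 t t01.
have : (r0 - 1)%:E < f (t *: z + (1 - t) *: x0)%R.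
  apply: near_ge.
  have -> : (x0 - (t *: z + (1 - t) *: x0) = (- t) *: (z - x0))%R.
    by apply/rowP => i; rewrite !mxE; ring.
  rewrite normrZ normrN gtr0_norm// -/N /t divfK ?gt_eqF//; lra.
move=> /lt_le_trans H /H; rewrite fx0E.
case: (f z) (fNy z) => [s| |] //= _; last by rewrite leey.
rewrite -!EFinM -EFinD lte_fin lee_fin => st.
have : (t * (r0 - s) < 1)%R by lra.
rewrite mulrC -ltr_pdivlMr// => {}st.
have : (1 / t = 2 / e * N)%R by rewrite /t; field; rewrite !gt_eqF.
by move=> tE; rewrite tE in st; lra.
Qed.

(** The quadratic term beats the at most linear decrease of [f], so the sublevel set at the value
    taken at [x0] is bounded. *)
Lemma moreau_objective_has_min (R : realType) (n : nat) (f : 'rV[R]_n -> \bar R)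
    (c : R) (y : 'rV[R]_n) :
  (0 < c)%R -> econvex f -> lower_semicontinuous f -> proper_fun f ->
  exists p, forall z, f p + (c * frakq (y - p))%:E <= f z + (c * frakq (y - z))%:E.
Proof.
move=> c0 f_convex f_lsc f_proper.
have [x0 [A [B [fx0 B0 fge]]]] := convex_lsc_norm_minorant f_convex f_lsc f_proper.
have fNy := f_proper.1.
pose h := (fun z => c * frakq (y - z))%R.
have [r0 fx0E] : exists r0, f x0 = r0%:E.
  by exists (fine (f x0)); rewrite fineK// fin_numElt fNy.
apply: (@lower_semicontinuous_has_min R n (fun z => f z + (h z)%:E) (r0 + h x0)).
- by move=> z; rewrite lteNye adde_eq_ninfty negb_or -lteNye fNy.
- exact/lower_semicontinuousD_continuous/continuous_moreau_kernel.
- by exists x0; rewrite /= fx0E.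
pose K := (r0 + h x0 - A + B * `|y - x0|)%R.
(* If [D > M], then [D > 1] and [c / 2 * D > B + |K|], so [c / 2 * D ^+ 2 - B * D] exceeds [K],
   contradicting [H1]. *)
pose M := (1 + 2 * (B + `|K|) / c)%R.
exists (`|y| + M)%R; split; first exact: num_real.
move=> M' MM' z /= hz; apply: le_trans (ltW MM').
have -> : z = (y - (y - z))%R by rewrite opprB addrC subrK.
apply: (le_trans (ler_normB _ _)); rewrite lerD2l.
have : (A - B * `|z - x0|)%:E + (h z)%:E <= (r0 + h x0)%:E.
  by apply: le_trans hz; rewrite leeD2r.
rewrite -EFinD lee_fin => {}hz.
have sq := sqr_norm_le_inner (y - z)%R.
have tri : (`|z - x0| <= `|y - z| + `|y - x0|)%R.
  by rewrite (distrC y z); exact: ler_distD.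
set D := `|y - z|%R in sq tri *.
rewrite leNgt; apply/negP => MD.
have hzE : (c / 2 * D ^+ 2 <= h z)%R.
  by rewrite /h frakqE -mulrA ler_pM2l// ler_pM2l.
have H1 : (c / 2 * D ^+ 2 - B * D <= K)%R.
  have : (B * `|z - x0| <= B * (D + `|y - x0|))%R by rewrite ler_pM2l.
  by rewrite /K; lra.
have KK := ler_norm K.
have K0 := normr_ge0 K.
have D1 : (1 < D)%R.
  apply: le_lt_trans MD; rewrite lerDl divr_ge0 ?(ltW c0)//.
  by rewrite mulr_ge0// addr_ge0// ltW.
have H2 : (B + `|K| < c / 2 * D)%R.
  have : (2 * (B + `|K|) / c < D)%R by rewrite /M in MD; lra.
  by rewrite ltr_pdivrMr//; lra.
nra.
Qed.

(** Here [p] minimises the envelope objective at [y], and its optimality condition says that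
    [(y - p) / mu] is a subgradient of [f] at [p]. *)
Lemma prox_decomposition (R : realType) (n : nat) (f : 'rV[R]_n -> \bar R)
    (mu : R) (y : 'rV[R]_n) :
  (0 < mu)%R -> econvex f -> lower_semicontinuous f -> proper_fun f ->
  exists p r w, subgradient f p r w /\ y = (p + mu *: w)%R.
Proof.
move=> mu0 f_convex f_lsc f_proper.
pose c := (mu^-1)%R.
have c0 : (0 < c)%R by rewrite invr_gt0.
have [p pmin] := moreau_objective_has_min y c0 f_convex f_lsc f_proper.
have [fNy [x1 fx1]] := f_proper.
have [r fp] : exists r, f p = r%:E.
  exists (fine (f p)); rewrite fineK// fin_numElt fNy/=.
  rewrite ltNge leye_eq; apply/eqP => fpy.
  have := pmin x1; rewrite fpy addye// leye_eq => /eqP H.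
  by case: (f x1) fx1 H.
exists p, r, (c *: (y - p))%R; split; last first.
  by rewrite scalerA mulfV ?gt_eqF// scale1r addrC subrK.
split=> // z.
case fz : (f z) (fNy z) => [s| |] // _; last by rewrite leey.
rewrite lee_fin innerZl leNgt; apply/negP => lt_s.
set e := (z - p)%R in lt_s *; set d := (y - p)%R in lt_s *.
(* The amount by which the subgradient inequality is assumed to fail at [z]. *)
pose del := (r + c * inner d e - s)%R.
have del0 : (0 < del)%R by rewrite /del; lra.
pose Q := (c * frakq e)%R.
have Q0 : (0 <= Q)%R by rewrite mulr_ge0 ?frakq_ge0// ltW.
(* Compare p with p + t e: for small t > 0 the quadratic term t Q is negligible. *)
pose t := (del / (2 * (Q + del)))%R.
have t01 : (0 < t < 1)%R.
  rewrite /t divr_gt0//=; last by lra.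
  by rewrite ltr_pdivrMr; lra.
have /andP[t0 t1] := t01.
have tQ : (t * Q < del)%R.
  rewrite /t mulrAC ltr_pdivrMr; last by lra.
  by rewrite ltr_pM2l//; lra.
have := f_convex z p t t01.
have := pmin (t *: z + (1 - t) *: p)%R.
have -> : (y - (t *: z + (1 - t) *: p) = d - t *: e)%R.
  by apply/rowP => i; rewrite /d /e !mxE; ring.
rewrite fp fz -!EFinM -!EFinD => H1 H2.
have := le_trans H1 (leeD2r _ H2).
rewrite -EFinD lee_fin -/d; clearbody d e.
rewrite /Q frakqE in tQ.
rewrite !frakqE !innerE.
rewrite (innerC e d) => H3.
(* Dividing by [t] leaves [del <= t * Q], against [tQ]. *)
have : (t * (r - s + c * inner d e - t * (c * (2^-1 * inner e e))) <= 0)%R by lra.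
rewrite pmulr_rle0// => H4.
by move: tQ; rewrite /del; lra.
Qed.

(** * Values and subgradients of the smoothing operator *)

Section Smoothing.
Context {R : realType} {n : nat}.
Implicit Types (f : 'rV[R]_n -> \bar R) (p u v w x y z : 'rV[R]_n) (r lambda : R).

(** Since [p] is the gradient of [frakq] at [p], the sum [f + frakq] has the subgradient [p + w]
    there; conjugation swaps the pair. *)
Lemma subgradient_fenchel_frakqD f p r w : subgradient f p r w ->
  subgradient (fenchel (fun z => f z + (frakq z)%:E)) (p + w)
    (frakq p + inner p w - r) p.
Proof.
move=> fpw.
have := subgradient_fenchel (subgradientD fpw (subgradient_frakq p)).
rewrite (addrC w); congr (subgradient _ _ _ _).
by rewrite !frakqE !innerE; lra.
Qed.

Lemma smoothing_subgradient lambda f p r w : (0 < lambda < 1)%R ->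
  subgradient f p r w ->
  let mu := (lambda / (2 - lambda))%R in
  let x := ((1 - lambda / 2) *: p + (lambda / 2) *: w)%R in
  smoothing lambda f x =
    ((1 - lambda) * (r + mu * frakq w) + mu * frakq x)%:E.
Proof.
move=> /andP[l0 l1] fpw mu x.
have l1' : (0 < 1 - lambda)%R by lra.
pose v := (p + w)%R.
have Hf := subgradientZ l1' (subgradient_fenchel_frakqD fpw).
(* The gradient of [frakq + frakq] doubles its argument, so the base point [v / 2] places the second
   conjugate's subgradient at the same [v] as the first. *)
have := subgradient_fenchel_frakqD (subgradient_frakq (2^-1 *: v)).
rewrite -scalerDl (_ : 2^-1 + 2^-1 = 1)%R ?scale1r; last by field.
move=> /(subgradientZ l0) Hq.
have := fenchel_subgradient (subgradientD Hf Hq).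
rewrite (_ : (1 - lambda) *: p + _ = x)%R; last first.
  by apply/rowP => i; rewrite !mxE; field.
rewrite /smoothing /pav => ->; rewrite -EFinB; congr EFin.
rewrite /mu /x /v !frakqE !innerE (innerC w p).
by field; lra.
Qed.

(** Every [x'] also comes from a subgradient pair of [f], so the inequality compares two explicit
    values. *)
Lemma subgradient_smoothing lambda f p r w :
  econvex f -> lower_semicontinuous f -> proper_fun f ->
  (0 < lambda < 1)%R -> subgradient f p r w ->
  let mu := (lambda / (2 - lambda))%R in
  let x := ((1 - lambda / 2) *: p + (lambda / 2) *: w)%R in
  subgradient (smoothing lambda f) x
    ((1 - lambda) * (r + mu * frakq w) + mu * frakq x)
    ((1 - lambda / 2) *: w + (lambda / 2) *: p).
Proof.
move=> f_convex f_lsc f_proper l01 fpw mu x.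
split; first exact: smoothing_subgradient.
have /andP[l0 l1] := l01.
have mu0 : (0 < mu)%R by rewrite divr_gt0//; lra.
move=> x'.
(* The scaling fits because [(1 - lambda / 2) * mu = lambda / 2]. *)
have [p' [r' [w' [fpw' x'E]]]] :=
  prox_decomposition ((1 - lambda / 2)^-1 *: x')%R mu0 f_convex f_lsc f_proper.
have {x'E} -> : (x' = (1 - lambda / 2) *: p' + (lambda / 2) *: w')%R.
  rewrite (canRL (scalerK _) x'E) ?invrK ?unitfE ?invr_eq0; last by lra.
  by apply/rowP => i; rewrite !mxE /mu; field; lra.
rewrite (smoothing_subgradient l01 fpw') lee_fin.
have := fpw.2 p'; rewrite fpw'.1 lee_fin => rr'.
rewrite -subr_ge0.
(* The gap is the convexity gap of f plus squares of the increments. *)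
pose dx := ((1 - lambda / 2) *: (p' - p) + (lambda / 2) *: (w' - w))%R.
have -> : ((1 - lambda) * (r' + mu * frakq w') +
    mu * frakq ((1 - lambda / 2) *: p' + (lambda / 2) *: w') -
    ((1 - lambda) * (r + mu * frakq w) + mu * frakq x +
     inner ((1 - lambda / 2) *: w + (lambda / 2) *: p)
       ((1 - lambda / 2) *: p' + (lambda / 2) *: w' - x)) =
    (1 - lambda) * (r' - (r + inner w (p' - p))) +
    mu * frakq dx + (1 - lambda) * mu * frakq (w' - w))%R.
  rewrite /dx /x /mu !frakqE !innerE (innerC w p) (innerC w' p') (innerC p' p).
  rewrite (innerC w' w) (innerC w p') (innerC w' p).
  by field; lra.
have l1_ge0 : (0 <= 1 - lambda)%R by lra.
have mu_ge0 := ltW mu0; clearbody mu.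
apply: addr_ge0; [apply: addr_ge0|]; rewrite mulr_ge0 ?frakq_ge0//.
- by rewrite subr_ge0.
- exact: mulr_ge0.
Qed.

End Smoothing.

(** * The envelope formula and the conjugation identity *)

Unset Implicit Arguments.
Set Strict Implicit.

Theorem theorem3p2 (R : realType) (n : nat) (f : 'rV[R]_n -> \bar R)
    (f_convex : econvex f) (f_lsc : lower_semicontinuous f)
    (f_proper : proper_fun f)
    (lambda : R) (lambda_in : (0 < lambda < 1)%R) :
  let mu : R := (lambda / (2 - lambda))%R in
  (forall x : 'rV[R]_n,
     smoothing lambda f x =
       (1 - lambda)%:E * moreau mu f ((2 / (2 - lambda)) *: x)%R
       + (mu * frakq x)%:E)
  /\ fenchel (smoothing lambda f) = smoothing lambda (fenchel f).
Proof.
move=> mu.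
have /andP[l0 l1] := lambda_in.
have mu0 : (0 < mu)%R by rewrite divr_gt0//; lra.
split=> [x|].
  have [p [r [w [fpw yE]]]] :=
    prox_decomposition ((2 / (2 - lambda)) *: x)%R mu0 f_convex f_lsc f_proper.
  rewrite yE (moreau_subgradient mu0 fpw).
  have -> : (x = (1 - lambda / 2) *: p + (lambda / 2) *: w)%R.
    rewrite (canRL (scalerK _) yE) ?unitfE; last by rewrite mulf_neq0 ?invr_eq0; lra.
    by apply/rowP => i; rewrite !mxE /mu; field; lra.
  by rewrite (smoothing_subgradient lambda_in fpw).
apply/funext => u.
(* With this proximal parameter, [lambda / 2] times the decomposition of [2 u / lambda] has the
   weights on [p] and [w] exchanged. *)
have c0 : (0 < (2 - lambda) / lambda)%R by rewrite divr_gt0//; lra.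
have [p [r [w [fpw uE]]]] :=
  prox_decomposition ((2 / lambda) *: u)%R c0 f_convex f_lsc f_proper.
have {uE} -> : (u = (1 - lambda / 2) *: w + (lambda / 2) *: p)%R.
  rewrite (canRL (scalerK _) uE) ?unitfE; last by rewrite mulf_neq0 ?invr_eq0; lra.
  by apply/rowP => i; rewrite !mxE; field; lra.
rewrite (smoothing_subgradient lambda_in (subgradient_fenchel fpw)).
rewrite (fenchel_subgradient
  (subgradient_smoothing f_convex f_lsc f_proper lambda_in fpw)).
congr EFin; rewrite !frakqE !innerE (innerC w p).
by field; lra.
Qed.
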